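(* Let $n\ge 3$ and let $\alpha:I\to E^n$ be a smooth unit speed curve with Frenet frame $\{V_1,\dots,V_n\}$, whose curvatures $k_1,\dots,k_{n-1}$ vanish nowhere on $I$. Then $\alpha$ is a $V_2$-slant helix if and only if, for some choice of the antiderivative $G_1=\int k_1(s)\,ds$ on $I$, the functions $G_1,\dots,G_n$ defined by $$G_1=\int k_1(s)\,ds,\quad G_2=1,\quad G_3=\frac{k_1}{k_2}G_1,\quad G_i=\frac{1}{k_{i-1}}\left[k_{i-2}G_{i-2}+G_{i-1}'\right]\ (4\le i\le n)$$ are such that $\sum_{i=1}^{n}G_i^2$ is constant on $I$ and $G_n$ is not identically zero on $I$.
   Context: $E^n$ is $\mathbb{R}^n$ with the standard inner product $\langle\cdot,\cdot\rangle$, $I\subset\mathbb{R}$ is an open interval, and $s\in I$ is the arc-length parameter; a prime denotes $d/ds$. Frenet frame: $V_1=\alpha'$, $\{V_1,\dots,V_n\}$ is a smooth orthonormal frame along $\alpha$, and the curvature functions $k_1,\dots,k_{n-1}:I\to\mathbb{R}$ satisfy the Frenet formulas $V_1'=k_1V_2$, $V_i'=-k_{i-1}V_{i-1}+k_iV_{i+1}$ for $2\le i\le n-1$, and $V_n'=-k_{n-1}V_{n-1}$. $V_2$-slant helix: $\alpha$ is called a slant helix or $V_2$-slant helix if there exist a constant unit vector $X\in E^n$ and a constant angle $\varphi\neq\frac{\pi}{2}$ such that $\langle V_2(s),X\rangle=\cos\varphi$ for all $s\in I$. $\int k_1(s)\,ds$ denotes an antiderivative of $k_1$ on $I$, i.e.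 a function with $G_1'=k_1$. *)

(* Defs.v *)
From mathcomp Require Import all_boot all_order all_algebra.
From mathcomp Require Import all_classical all_reals all_analysis.
Import Order.TTheory GRing.Theory Num.Theory.
Import numFieldNormedType.Exports.

Set Implicit Arguments.
Unset Strict Implicit.
Unset Printing Implicit Defensive.

Local Open Scope classical_set_scope.
Local Open Scope ring_scope.

(* Curves, frames and curvatures are total functions on R of which only the
   values on the open set I matter; since I is open, so do derivatives at points
   of I.  The families V_1, .., V_n and k_1, .., k_(n-1) are indexed by nat,
   starting at 1; indices out of these ranges are never constrained. *)

Definition dotv (R : realType) (n : nat) (u v : 'rV[R]_n) : R :=
  \sum_(i < n) u 0 i * v 0 i.

Definition smooth_on (R : realType) (W : normedModType R) (I : set R)
    (f : R -> W) : Prop :=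
  forall (m : nat) (s : R), I s -> derivable (derive1n m f) s 1.

Definition unit_speed (R : realType) (n : nat) (I : set R)
    (alpha : R -> 'rV[R]_n) : Prop :=
  forall s, I s -> Num.sqrt (dotv (derive1 alpha s) (derive1 alpha s)) = 1.

Definition frenet_frame (R : realType) (n : nat) (I : set R)
    (alpha : R -> 'rV[R]_n) (V : nat -> R -> 'rV[R]_n) (k : nat -> R -> R) :
    Prop :=
  [/\ forall i, (1 <= i <= n)%N -> smooth_on I (V i),
      forall s, I s -> V 1%N s = derive1 alpha s,
      forall i j s, (1 <= i <= n)%N -> (1 <= j <= n)%N -> I s ->
        dotv (V i s) (V j s) = (i == j)%:R &
      forall s, I s ->
        [/\ derive1 (V 1%N) s = k 1%N s *: V 2%N s,
            forall i, (2 <= i <= n.-1)%N ->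
              derive1 (V i) s = - k i.-1 s *: V i.-1 s + k i s *: V i.+1 s &
            derive1 (V n) s = - k n.-1 s *: V n.-1 s]].

(* phi is the angle between two unit vectors, hence ranges over [0, pi]. *)
Definition V2_slant_helix (R : realType) (n : nat) (I : set R)
    (V : nat -> R -> 'rV[R]_n) : Prop :=
  exists (X : 'rV[R]_n) (phi : R),
    [/\ dotv X X = 1, 0 <= phi <= pi, phi != pi / 2 &
        forall s, I s -> dotv (V 2%N s) X = cos phi].

Definition antiderivative_on (R : realType) (I : set R) (f F : R -> R) : Prop :=
  forall s, I s -> is_derive s 1 F (f s).

(* In the last case the index is j.+2 with j >= 2; index 0 is a dummy. *)
Fixpoint slant_G (R : realType) (k : nat -> R -> R) (G1 : R -> R) (i : nat) :
    R -> R :=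
  match i with
  | 0 => fun=> 0
  | 1 => G1
  | 2 => fun=> 1
  | 3 => fun s => k 1%N s / k 2%N s * G1 s
  | (j.+1 as j1).+1 => fun s =>
      (k j1 s)^-1 * (k j s * slant_G k G1 j s + derive1 (slant_G k G1 j1) s)
  end.

(* Main.v *)
Require Import Defs.
From mathcomp Require Import all_boot all_order all_algebra.
From mathcomp Require Import all_classical all_reals all_analysis.
From mathcomp Require Import ring zify.
Import Order.TTheory GRing.Theory Num.Theory.
Import numFieldNormedType.Exports.
Local Open Scope classical_set_scope.
Local Open Scope ring_scope.

Set Implicit Arguments.
Unset Strict Implicit.
Unset Printing Implicit Defensive.

(** The components x_i = <V_i, X> of a constant vector X in the Frenet frame
satisfy the skew-symmetric linear system
  x_i' = k_i x_(i+1) - k_(i-1) x_(i-1)   (1 <= i <= n),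
the missing terms at both ends being zero.  For two solutions x and y, the
derivative of x_1 y_1 + .. + x_n y_n telescopes to zero
([frenet_rhs_pairing]).  The recursion defining G_1, .., G_n is this system
with equations 1, .., n-1 solved for the next unknown, normalized by G_2 = 1.

If <V_2, X> is a nonzero constant c, then the components of X / c solve the
system and have x_2 = 1, so they are G_1, .., G_n ([slant_G_unique]).  Pairing
this solution with itself shows that the sum of squares is constant.  If G_n
vanished on I, the system read downwards would kill G_(n-1), .., G_2, which
contradicts G_2 = 1 ([V2_constant_slant_G]).

Conversely, G_1, .., G_n satisfy every equation but the last, whose defect is
e = G_n' + k_(n-1) G_(n-1).  The sum of squares has derivative 2 e G_n, so
e G_n = 0.  If e = 0 on all of I, then W = G_1 V_1 + .. + G_n V_n has constant
coordinates, because these are pairings of two solutions; moreover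
<V_2, W> = G_2 = 1 and <W, W> is the sum of squares, so W normalized is the axis
([slant_G_V2_constant]).

The delicate point is that e could a priori be nonzero where G_n vanishes
identically on some subinterval ([slant_G_system_exact]).  Let U be the set
where G_n is nonzero and Z the interior of its zero set; their union is dense
in I.  The sums p + q of smooth functions with p = 0 on Z and q = 0 on U are
stable under differentiation and under multiplication by smooth functions, and
they include G_n (zero on Z) and e (zero on U).  Reading the system downwards
([frenet_system_zero_split]), they include G_2 = 1 = p + q.  Then p is 1 on U
and 0 on Z, so p' vanishes on a dense set, hence on I; therefore p is constant,
and as U is nonempty, Z is empty.  So U is dense, and e = 0 on I.
Reading the system downwards differentiates repeatedly, which is where
smoothness enters. *)

(** * Derivatives and smooth functions on an open set *)

Section Derivatives.
Context {R : realType} {I : set R}.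
Implicit Types f g h : R -> R.

Lemma antiderivative_on_congr f f' g g' : open I ->
  (forall s, I s -> f s = g s) -> (forall s, I s -> f' s = g' s) ->
  antiderivative_on I f' f -> antiderivative_on I g' g.
Proof.
move=> I_open fg fg' df s Is; rewrite -fg'//.
apply: near_eq_is_derive (df s Is).
by apply: filterS (open_nbhs_nbhs (conj I_open Is)) => t; exact: fg.
Qed.

Lemma antiderivative_on_derive1 f g s :
  antiderivative_on I g f -> I s -> derive1 f s = g s.
Proof. by move=> df /df[_]; rewrite derive1E. Qed.

Lemma antiderivative_on_uniq f g g' s : antiderivative_on I g f ->
  antiderivative_on I g' f -> I s -> g s = g' s.
Proof.
move=> df df' Is.
by rewrite -(antiderivative_on_derive1 df Is) (antiderivative_on_derive1 df').
Qed.

Lemma antiderivative_onD f f' g g' :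
  antiderivative_on I f' f -> antiderivative_on I g' g ->
  antiderivative_on I (fun s => f' s + g' s) (fun s => f s + g s).
Proof. by move=> df dg s Is; apply: is_deriveD; [exact: df|exact: dg]. Qed.

Lemma antiderivative_onM f f' g g' :
  antiderivative_on I f' f -> antiderivative_on I g' g ->
  antiderivative_on I (fun s => f' s * g s + f s * g' s) (fun s => f s * g s).
Proof.
move=> df dg s Is.
have := @is_deriveM R R f g s 1 (f' s) (g' s) (df s Is) (dg s Is).
by rewrite /GRing.scale/= addrC [g s * _]mulrC.
Qed.

Lemma antiderivative_onV f f' : (forall s, I s -> f s != 0) ->
  antiderivative_on I f' f ->
  antiderivative_on I (fun s => (-1 * f' s) * ((f s)^-1 * (f s)^-1))
    (fun s => (f s)^-1).
Proof.
move=> f0 df s Is.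
have -> : (-1 * f' s) * ((f s)^-1 * (f s)^-1) = - (f s) ^- 2 *: f' s.
  by rewrite -expr2 exprVn mulN1r mulNr mulrC -mulNr.
by apply: is_deriveV; [exact: f0|exact: df].
Qed.

Lemma antiderivative_on_cst (c : R) : antiderivative_on I (fun=> 0) (fun=> c).
Proof. by move=> s _; exact: is_derive_cst. Qed.

Lemma antiderivative_on_sum (f f' : nat -> R -> R) m :
  (forall i, (1 <= i <= m)%N -> antiderivative_on I (f' i) (f i)) ->
  antiderivative_on I (fun s => \sum_(1 <= i < m.+1) f' i s)
    (fun s => \sum_(1 <= i < m.+1) f i s).
Proof.
elim: m => [|m IHm] df.
  under [X in antiderivative_on _ X _]eq_fun do rewrite big_geq//.
  under eq_fun do rewrite big_geq//.
  exact: antiderivative_on_cst.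
under [X in antiderivative_on _ X _]eq_fun do rewrite big_nat_recr//=.
under eq_fun do rewrite big_nat_recr//=.
apply: antiderivative_onD; last by apply: df; rewrite leqnn.
by apply: IHm => i /andP[i0 im]; apply: df; rewrite i0 leqW.
Qed.

(** A function is differentiable on I but may be known to be constant on a
smaller open set only; openness makes its derivative vanish there. *)
Lemma antiderivative_on_open_cst (A : set R) (c : R) f f' s :
  open A -> A `<=` I -> antiderivative_on I f' f ->
  (forall t, A t -> f t = c) -> A s -> f' s = 0.
Proof.
move=> A_open AI df fc As.
have [_ <-] := df s (AI s As).
rewrite (@near_eq_derive _ _ _ _ (fun=> c)) ?derive_cst//.
by apply: filterS (open_nbhs_nbhs (conj A_open As)) => t; exact: fc.
Qed.

Lemma antiderivative_on_eq0_cst f s t : is_interval I ->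
  antiderivative_on I (fun=> 0) f -> I s -> I t -> f s = f t.
Proof.
move=> I_itv df; wlog st : s t / s <= t.
  by move=> H Is It; case: (leP s t) => [|/ltW] /H ->.
move=> Is It.
have stI x : x \in `[s, t] -> I x.
  by rewrite in_itv/=; exact: I_itv.
have [||c _] := @MVT_segment R f (fun=> 0) s t st.
- by move=> x /subset_itv_oo_cc /stI /df.
- by apply: derivable_within_continuous => x /stI /df[].
- by rewrite mul0r => /eqP; rewrite subr_eq0 => /eqP.
Qed.

Lemma antiderivative_on_near_neq0 f f' s : antiderivative_on I f' f ->
  I s -> f s != 0 -> \forall t \near s, f t != 0.
Proof.
move=> df Is fs0.
have fc : {for s, continuous f}.
  by apply/differentiable_continuous/derivable1_diffP; case: (df s Is).
apply: (cvgr_neq0 (f s) fc fs0).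
Qed.

(** Smoothness is recast through successive derivatives that are prescribed on I
only; the values outside I being free, the product and quotient rules give the
next derivative by a formula and closure properties follow by induction. *)
Fixpoint derivable_upto m f : Prop :=
  if m is m'.+1 then exists2 g, antiderivative_on I g f & derivable_upto m' g
  else True.

Context (I_open : open I).

Lemma derivable_upto_congr m f g : (forall s, I s -> f s = g s) ->
  derivable_upto m f -> derivable_upto m g.
Proof.
case: m => // m fg [f' df f'm]; exists f' => //.
exact: (antiderivative_on_congr _ fg).
Qed.

Lemma derivable_uptoW m f : derivable_upto m.+1 f -> derivable_upto m f.
Proof.
elim: m f => // m IHm f [f' df /IHm f'm].
by exists f'.
Qed.

Lemma derivable_uptoD m f g :
  derivable_upto m f -> derivable_upto m g ->
  derivable_upto m (fun s => f s + g s).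
Proof.
elim: m f g => // m IHm f g [f' df mf] [g' dg mg].
by exists (fun s => f' s + g' s); [exact: antiderivative_onD|exact: IHm].
Qed.

Lemma derivable_uptoM m f g :
  derivable_upto m f -> derivable_upto m g ->
  derivable_upto m (fun s => f s * g s).
Proof.
elim: m f g => // m IHm f g mf mg.
have [f' df mf'] := mf; have [g' dg mg'] := mg.
exists (fun s => f' s * g s + f s * g' s); first exact: antiderivative_onM.
by apply: derivable_uptoD; apply: IHm => //; exact: derivable_uptoW.
Qed.

Lemma derivable_upto_cst m (c : R) : derivable_upto m (fun=> c).
Proof.
elim: m c => // m IHm c; exists (fun=> 0); last exact: IHm.
exact: antiderivative_on_cst.
Qed.

Lemma derivable_uptoV m f : (forall s, I s -> f s != 0) ->
  derivable_upto m f -> derivable_upto m (fun s => (f s)^-1).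
Proof.
move=> f0; elim: m => // m IHm mf.
have mfV := IHm (derivable_uptoW mf); have [f' df mf'] := mf.
exists (fun s => (-1 * f' s) * ((f s)^-1 * (f s)^-1)).
  exact: antiderivative_onV.
apply: derivable_uptoM; last exact: derivable_uptoM.
by apply: derivable_uptoM => //; exact: derivable_upto_cst.
Qed.

Lemma smooth_on_derive1 (W : normedModType R) (F : R -> W) :
  smooth_on I F -> smooth_on I (derive1 F).
Proof. by move=> sF m s Is; rewrite -derive1Sn; exact: sF. Qed.

Lemma smooth_on_antiderivative f :
  smooth_on I f -> antiderivative_on I (derive1 f) f.
Proof.
move=> sf s Is; rewrite derive1E; apply/derivableP.
by have := sf 0%N s Is.
Qed.

Lemma smooth_onP f : smooth_on I f <-> forall m, derivable_upto m f.
Proof.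
split=> [sf m|].
  elim: m f sf => // m IHm f sf; exists (derive1 f).
    exact: smooth_on_antiderivative.
  exact/IHm/smooth_on_derive1.
move=> mf m; have {mf} := mf m.+1.
elim: m f => [|m IHm] f [f' df mf'] s Is; first by case: (df s Is).
rewrite derive1Sn; apply: IHm => //.
(* f' is only known to agree with the derivative of f on I *)
have f'E t : I t -> f' t = derive1 f t.
  by move=> It; rewrite (antiderivative_on_derive1 df It).
exact: (@derivable_upto_congr m.+1 _ _ f'E mf').
Qed.

Lemma smooth_on_congr f g : (forall s, I s -> f s = g s) ->
  smooth_on I f -> smooth_on I g.
Proof.
move=> fg /smooth_onP mf; apply/smooth_onP => m.
exact: (derivable_upto_congr fg (mf m)).
Qed.

Lemma smooth_onD f g : smooth_on I f -> smooth_on I g ->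
  smooth_on I (fun s => f s + g s).
Proof.
move=> /smooth_onP mf /smooth_onP mg.
by apply/smooth_onP => m; exact: derivable_uptoD.
Qed.

Lemma smooth_onM f g : smooth_on I f -> smooth_on I g ->
  smooth_on I (fun s => f s * g s).
Proof.
move=> /smooth_onP mf /smooth_onP mg.
by apply/smooth_onP => m; exact: derivable_uptoM.
Qed.

Lemma smooth_on_cst (c : R) : smooth_on I (fun=> c : R).
Proof. by apply/smooth_onP => m; exact: derivable_upto_cst. Qed.

Lemma smooth_onB f g : smooth_on I f -> smooth_on I g ->
  smooth_on I (fun s => f s - g s).
Proof.
move=> sf sg; have := smooth_onD sf (smooth_onM (@smooth_on_cst (-1)) sg).
by apply: smooth_on_congr => s _; rewrite mulN1r.
Qed.

Lemma smooth_onV f : (forall s, I s -> f s != 0) -> smooth_on I f ->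
  smooth_on I (fun s => (f s)^-1).
Proof.
move=> f0 /smooth_onP mf.
by apply/smooth_onP => m; exact: derivable_uptoV.
Qed.

Lemma smooth_on_sum (J : finType) (f : J -> R -> R) :
  (forall j, smooth_on I (f j)) -> smooth_on I (fun s => \sum_j f j s).
Proof.
move=> sf; elim: (index_enum J) => [|j r IHr].
  under eq_fun do rewrite big_nil; exact: smooth_on_cst.
by under eq_fun do rewrite big_cons; exact: (smooth_onD (sf j) IHr).
Qed.

Lemma antiderivative_on_smooth f g :
  antiderivative_on I g f -> smooth_on I g -> smooth_on I f.
Proof.
move=> df /smooth_onP mg; apply/smooth_onP => -[//|m].
by exists g.
Qed.

Lemma smooth_on_coord n (F : R -> 'rV[R]_n) (c : 'I_n) :
  smooth_on I F -> smooth_on I (fun s => F s 0 c).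
Proof.
move=> sF; apply/smooth_onP => m; elim: m F sF => // m IHm F sF.
exists (fun s => derive1 F s 0 c); last exact/IHm/smooth_on_derive1.
move=> s Is; have dF : derivable F s 1 := sF 0%N s Is.
rewrite derive1E derive_mx// mxE; apply/derivableP.
by move/derivable_mxP : dF; exact.
Qed.

Lemma smooth_on_dotv n (F H : R -> 'rV[R]_n) :
  smooth_on I F -> smooth_on I H -> smooth_on I (fun s => dotv (F s) (H s)).
Proof.
move=> sF sH; apply: smooth_on_sum => c.
exact: (smooth_onM (@smooth_on_coord n F c sF) (@smooth_on_coord n H c sH)).
Qed.

Lemma antiderivative_on_dotv n (F : R -> 'rV[R]_n) X : smooth_on I F ->
  antiderivative_on I (fun s => dotv (derive1 F s) X) (fun s => dotv (F s) X).
Proof.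
move=> sF s Is; have dF : derivable F s 1 := sF 0%N s Is.
rewrite /dotv derive1E derive_mx//.
have -> : (fun s => \sum_(i < n) F s 0 i * X 0 i) =
    \sum_(i < n) (fun s => F s 0 i * X 0 i).
  by apply/funext => t; rewrite fct_sumE.
apply: is_derive_sum => i; rewrite mxE mulrC.
under eq_fun do rewrite mulrC.
apply: is_deriveZ; apply/derivableP.
by move/derivable_mxP : dF; exact.
Qed.

End Derivatives.

(** * Functions split over a zero set *)

Section ZeroSet.
Context {R : realType} {I : set R}.
Context (I_open : open I).
Implicit Types f g : R -> R.

Definition zero_interior g : set R := (I `&` [set s | g s = 0])°.
Definition nonzero_set g : set R := I `&` [set s | g s != 0].

Lemma zero_interiorS g s : zero_interior g s -> I s /\ g s = 0.
Proof. by move=> /interior_subset. Qed.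

Lemma zero_interior_open g : open (zero_interior g).
Proof. exact: open_interior. Qed.

Lemma nonzero_set_open g g' : antiderivative_on I g' g -> open (nonzero_set g).
Proof.
move=> dg; rewrite openE => s [Is gs0]; rewrite /interior.
apply: filterI; first exact: open_nbhs_nbhs.
exact: antiderivative_on_near_neq0 dg Is gs0.
Qed.

(** Density of the union of the two sets: a point where f is nonzero has a
neighbourhood that avoids the first set, on which g is therefore zero, which
puts the point in the second set. *)
Lemma zero_or_nonzero_dense g f f' s : antiderivative_on I f' f ->
  (forall t, nonzero_set g t -> f t = 0) ->
  (forall t, zero_interior g t -> f t = 0) -> I s -> f s = 0.
Proof.
move=> df fU fZ Is; have [//|fs0] := eqVneq (f s) 0.
apply: fZ; apply: filterI; first exact: open_nbhs_nbhs.
apply: filterS2 (antiderivative_on_near_neq0 df Is fs0)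
  (open_nbhs_nbhs (conj I_open Is)).
move=> t ft0 It; have [//|gt0] := eqVneq (g t) 0.
by move: ft0; rewrite fU ?eqxx.
Qed.

(** For A and B open, these functions form a differential ideal of the smooth
functions on I: the sum of the ideals of the functions vanishing on A and
on B.  It replaces the ideal of functions flat at a common boundary point of A
and B, without any pointwise higher derivatives. *)
Definition zero_split (A B : set R) f := exists p q,
  [/\ smooth_on I p, smooth_on I q, forall s, A s -> p s = 0,
      forall s, B s -> q s = 0 & forall s, I s -> f s = p s + q s].

Lemma zero_split_congr A B f g : (forall s, I s -> f s = g s) ->
  zero_split A B f -> zero_split A B g.
Proof.
move=> fg [p [q [sp sq pA qB fE]]]; exists p, q; split=> // s Is.
by rewrite -fg// fE.
Qed.

Lemma zero_splitM A B f g : smooth_on I g ->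
  zero_split A B f -> zero_split A B (fun s => g s * f s).
Proof.
move=> sg [p [q [sp sq pA qB fE]]].
exists (fun s => g s * p s), (fun s => g s * q s).
split; [exact: (smooth_onM I_open sg sp)|exact: (smooth_onM I_open sg sq)|..].
- by move=> s /pA ->; rewrite mulr0.
- by move=> s /qB ->; rewrite mulr0.
- by move=> s /fE ->; rewrite mulrDr.
Qed.

Lemma zero_splitB A B f g :
  zero_split A B f -> zero_split A B g -> zero_split A B (fun s => f s - g s).
Proof.
move=> [p [q [sp sq pA qB fE]]] [p' [q' [sp' sq' p'A q'B gE]]].
exists (fun s => p s - p' s), (fun s => q s - q' s).
split; [exact: (smooth_onB I_open sp sp')|exact: (smooth_onB I_open sq sq')|..].
- by move=> s As; rewrite pA// p'A// subr0.
- by move=> s Bs; rewrite qB// q'B// subr0.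
- by move=> s Is; rewrite fE// gE// opprD addrACA.
Qed.

Lemma zero_split_deriv A B f f' : open A -> open B -> A `<=` I -> B `<=` I ->
  antiderivative_on I f' f -> zero_split A B f -> zero_split A B f'.
Proof.
move=> oA oB AI BI df [p [q [sp sq pA qB fE]]].
have dp := smooth_on_antiderivative sp; have dq := smooth_on_antiderivative sq.
exists (derive1 p), (derive1 q); split; [exact: smooth_on_derive1..| | |].
- by move=> s; exact: (antiderivative_on_open_cst oA AI dp pA).
- by move=> s; exact: (antiderivative_on_open_cst oB BI dq qB).
- have dpq : antiderivative_on I (fun s => derive1 p s + derive1 q s) f.
    by apply: antiderivative_on_congr (antiderivative_onD dp dq) => // t /fE.
  by move=> s; exact: antiderivative_on_uniq df dpq.
Qed.

End ZeroSet.

(** * The skew-symmetric Frenet system *)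

Section System.
Context {R : realType} {I : set R}.
Context (I_open : open I).
Context (n : nat) (k : nat -> R -> R).
Implicit Types (x y : nat -> R -> R) (e d : R -> R).

(** The two tests set k_0 and k_n to zero, so that the end equations have the
same form as the others whatever the values of k, x_0 and x_(n+1). *)
Definition frenet_rhs x i s : R :=
  (if (i < n)%N then k i s * x i.+1 s else 0) -
  (if (1 < i)%N then k i.-1 s * x i.-1 s else 0).

(** The defect e in the last equation is there for the functions G_i, which
solve the other equations by construction. *)
Definition frenet_system e x := forall i, (1 <= i <= n)%N ->
  antiderivative_on I
    (fun s => frenet_rhs x i s + (if i == n then e s else 0)) (x i).

(** With T_i = k_i (x_(i+1) y_i + x_i y_(i+1)), the i-th summand is
T_i - T_(i-1) up to the defects, and T_0 = T_n = 0: the system is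
skew-symmetric. *)
Lemma frenet_rhs_pairing x y e d s : (0 < n)%N ->
  \sum_(1 <= i < n.+1)
    ((frenet_rhs x i s + (if i == n then e s else 0)) * y i s +
     x i s * (frenet_rhs y i s + (if i == n then d s else 0))) =
  e s * y n s + x n s * d s.
Proof.
move=> n0.
have telescope m : (m < n)%N -> \sum_(1 <= i < m.+1)
    ((frenet_rhs x i s + (if i == n then e s else 0)) * y i s +
     x i s * (frenet_rhs y i s + (if i == n then d s else 0))) =
    if (0 < m)%N then k m s * (x m.+1 s * y m s + x m s * y m.+1 s) else 0.
  elim: m => [|m IHm] mn; first by rewrite big_geq.
  rewrite big_nat_recr//= (IHm (ltnW mn)) /frenet_rhs mn (ltn_eqF mn) ltnS.
  by case: ifP => _ /=; ring.
have := telescope n.-1; rewrite prednK// leqnn => /(_ isT) tel.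
rewrite big_nat_recr//= tel /frenet_rhs ltnn eqxx.
have -> : (1 < n)%N = (0 < n.-1)%N by case: (n) n0.
case: ifP => _; last by ring.
ring.
Qed.

Lemma frenet_system_pairing e d x y : (0 < n)%N ->
  frenet_system e x -> frenet_system d y ->
  antiderivative_on I (fun s => e s * y n s + x n s * d s)
    (fun s => \sum_(1 <= i < n.+1) x i s * y i s).
Proof.
move=> n0 dx dy.
have := antiderivative_on_sum
  (fun i i1n => antiderivative_onM (dx i i1n) (dy i i1n)).
by under [X in antiderivative_on _ X _]eq_fun do rewrite frenet_rhs_pairing//.
Qed.

Lemma frenet_system_pairing_cst x y s t : is_interval I -> (0 < n)%N ->
  frenet_system (fun=> 0) x -> frenet_system (fun=> 0) y -> I s -> I t ->
  \sum_(1 <= i < n.+1) x i s * y i s = \sum_(1 <= i < n.+1) x i t * y i t.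
Proof.
move=> I_itv n0 dx dy.
have d0 : antiderivative_on I (fun=> 0)
    (fun r => \sum_(1 <= i < n.+1) x i r * y i r).
  apply: antiderivative_on_congr (frenet_system_pairing n0 dx dy) => // r _.
  by rewrite mul0r mulr0 addr0.
exact: antiderivative_on_eq0_cst I_itv d0.
Qed.

Context (k_neq0 : forall i s, (1 <= i <= n.-1)%N -> I s -> k i s != 0).
Context (k_smooth : forall i, (1 <= i <= n.-1)%N -> smooth_on I (k i)).

(** The i-th equation expresses x_(i-1) by x_i' and x_(i+1), with a division by
k_(i-1); starting from x_n and the defect, a differential ideal thus absorbs
x_(n-1), .., x_2 in turn. *)
Lemma frenet_system_zero_split A B e x :
  open A -> open B -> A `<=` I -> B `<=` I -> (2 < n)%N ->
  frenet_system e x -> zero_split (I:=I) A B e -> zero_split (I:=I) A B (x n) ->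
  zero_split (I:=I) A B (x 2%N).
Proof.
move=> oA oB AI BI n2 dx Je Jxn.
have kV_smooth i : (1 <= i <= n.-1)%N -> smooth_on I (fun s => (k i s)^-1).
  move=> i1n; apply: (smooth_onV I_open); last exact: k_smooth.
  by move=> s; exact: k_neq0.
(* induction on the distance j + 1 from m to n *)
suff down j m : (m + j.+1)%N = n -> (2 <= m)%N ->
    zero_split (I:=I) A B (x m) /\ zero_split (I:=I) A B (x m.+1).
  by have [] := down (n - 3)%N 2%N; [lia|by []|].
elim: j m => [|j IHj] m mjn m2.
  have mE : m.+1 = n by lia.
  rewrite mE; split=> //.
  have i1n : (1 <= m <= n.-1)%N by lia.
  have nn : (1 <= n <= n)%N by lia.
  have J' := zero_split_deriv I_open oA oB AI BI (dx n nn) Jxn.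
  have := zero_splitM I_open (kV_smooth m i1n) (zero_splitB I_open Je J').
  apply: zero_split_congr => s Is.
  rewrite /frenet_rhs ltnn eqxx -mE ifT ?ltnS// /=; last lia.
  by field; exact: k_neq0.
have [Jm1 Jm2] := IHj m.+1 ltac:(lia) ltac:(lia).
split=> //.
have m1n : (1 <= m <= n.-1)%N by lia.
have m2n : (1 <= m.+1 <= n.-1)%N by lia.
have nn : (1 <= m.+1 <= n)%N by lia.
have J' := zero_split_deriv I_open oA oB AI BI (dx m.+1 nn) Jm1.
have Jk := zero_splitM I_open (k_smooth m2n) Jm2.
have := zero_splitM I_open (kV_smooth m m1n) (zero_splitB I_open Jk J').
apply: zero_split_congr => s Is.
have mn : (m.+1 < n)%N by lia.
rewrite /frenet_rhs mn (ltn_eqF mn) ltnS (ltnW m2)/=.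
by field; exact: k_neq0.
Qed.

(** The third function fits the general recursion because the second one is
constant. *)
Lemma slant_G_rec (G1 : R -> R) i s : (0 < i)%N ->
  slant_G k G1 i.+2 s =
  (k i.+1 s)^-1 * (k i s * slant_G k G1 i s + derive1 (slant_G k G1 i.+1) s).
Proof.
case: i => [//|[|i]] _ //=.
by rewrite derive1_cst addr0 mulrA [k 1%N s / _]mulrC.
Qed.

(** Equations 1, .., n-1 of the system determine x_3, .., x_n from x_1 and
x_2. *)
Lemma slant_G_unique e x i s : (1 < n)%N ->
  frenet_system e x -> (forall t, I t -> x 2%N t = 1) ->
  (1 <= i <= n)%N -> I s -> slant_G k (x 1%N) i s = x i s.
Proof.
move=> n1 dx x2.
suff up m : (m.+2 <= n)%N ->
    (forall t, I t -> slant_G k (x 1%N) m.+1 t = x m.+1 t) /\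
    (forall t, I t -> slant_G k (x 1%N) m.+2 t = x m.+2 t).
  case: i => [//|[|i]] /andP[_ ni] Is; first by [].
  exact: (up i ni).2.
elim: m => [|m IHm] mn; first by split=> // t /x2.
have [G1 G2] := IHm (ltnW mn); split=> // t It.
have m1n : (1 <= m.+2 <= n)%N by lia.
have dG : antiderivative_on I
    (fun s => frenet_rhs x m.+2 s + (if m.+2 == n then e s else 0))
    (slant_G k (x 1%N) m.+2).
  by apply: antiderivative_on_congr (dx m.+2 m1n) => // r Ir; rewrite G2.
rewrite slant_G_rec// (antiderivative_on_derive1 dG It) G1//.
rewrite /frenet_rhs mn (ltn_eqF mn)/=.
by field; apply: k_neq0 => //; lia.
Qed.

Lemma slant_G_smooth G1 i : antiderivative_on I (k 1%N) G1 -> (2 < n)%N ->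
  (1 <= i <= n)%N -> smooth_on I (slant_G k G1 i).
Proof.
move=> dG1 n2.
suff up m : (m.+2 <= n)%N ->
    smooth_on I (slant_G k G1 m.+1) /\ smooth_on I (slant_G k G1 m.+2).
  case: i => [//|[|i]] /andP[_ ni]; last exact: (up i ni).2.
  by apply: (up 0%N _).1; lia.
elim: m => [|m IHm] mn.
  split; last exact: smooth_on_cst.
  by apply: (antiderivative_on_smooth I_open dG1); apply: k_smooth; lia.
have [sG1 sG2] := IHm (ltnW mn); split; first exact: sG2.
have sk : smooth_on I (k m.+1) by apply: k_smooth; lia.
have skV : smooth_on I (fun s => (k m.+2 s)^-1).
  apply: (smooth_onV I_open); last by apply: k_smooth; lia.
  by move=> s; apply: k_neq0; lia.
have := smooth_onM I_open skV
  (smooth_onD I_open (smooth_onM I_open sk sG1) (smooth_on_derive1 sG2)).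
by apply: (smooth_on_congr I_open) => s _; rewrite slant_G_rec.
Qed.

Lemma slant_G_system G1 : antiderivative_on I (k 1%N) G1 -> (2 < n)%N ->
  frenet_system
    (fun s => derive1 (slant_G k G1 n) s + k n.-1 s * slant_G k G1 n.-1 s)
    (slant_G k G1).
Proof.
move=> dG1 n2 i i1n.
have dG := smooth_on_antiderivative (slant_G_smooth dG1 n2 i1n).
apply: antiderivative_on_congr dG => // s Is.
have [i_n|n_i] := ltnP i n; last first.
  have -> : i = n by lia.
  by rewrite /frenet_rhs ltnn eqxx (ltnW n2) sub0r addrC addrK.
rewrite /frenet_rhs i_n (ltn_eqF i_n).
case: i i1n i_n => [//|[|i]] i1n i_n.
  by rewrite (antiderivative_on_derive1 dG1 Is) /= mulr1 subr0 addr0.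
rewrite slant_G_rec// -[(1 < i.+2)%N]/true /= addr0 mulVKf; last first.
  by apply: k_neq0 => //; lia.
by rewrite addrAC subrr add0r.
Qed.

End System.

(** * Constant vectors in a Frenet frame *)

Section DotProduct.
Context {R : realType} {n : nat}.
Implicit Types u v w : 'rV[R]_n.

Lemma dotvC u v : dotv u v = dotv v u.
Proof. by apply: eq_bigr => i _; rewrite mulrC. Qed.

Lemma dotvDl u v w : dotv (u + v) w = dotv u w + dotv v w.
Proof. by rewrite -big_split; apply: eq_bigr => i _; rewrite mxE mulrDl. Qed.

Lemma dotvZl a u w : dotv (a *: u) w = a * dotv u w.
Proof. by rewrite mulr_sumr; apply: eq_bigr => i _; rewrite mxE mulrA. Qed.

Lemma dotv_suml m (a : nat -> R) (u : nat -> 'rV[R]_n) w :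
  dotv (\sum_(1 <= i < m) a i *: u i) w = \sum_(1 <= i < m) a i * dotv (u i) w.
Proof.
elim/big_ind2: _ => [|? x ? y <- <-|i _]; last by rewrite dotvZl.
  by rewrite /dotv big1// => i _; rewrite mxE mul0r.
by rewrite dotvDl.
Qed.

Lemma dotv_delta u c : dotv u (delta_mx 0 c) = u 0 c.
Proof.
rewrite /dotv (bigD1 c)//= mxE !eqxx mulr1 big1 ?addr0// => i ic.
by rewrite mxE (negPf ic) mulr0.
Qed.

End DotProduct.

Section Frenet.
Context {R : realType} {I : set R}.
Context (I_open : open I).
Context (n : nat) (alpha : R -> 'rV[R]_n) (V : nat -> R -> 'rV[R]_n)
  (k : nat -> R -> R).
Context (n2 : (2 < n)%N) (frV : frenet_frame I alpha V k).

Lemma frenet_frame_system X :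
  frenet_system (I:=I) n k (fun=> 0) (fun i s => dotv (V i s) X).
Proof.
move=> i i1n; have [sV _ _ dV] := frV.
apply: antiderivative_on_congr (antiderivative_on_dotv X (sV i i1n)) => //.
move=> s Is; have [dV1 dVi dVn] := dV s Is.
rewrite (_ : (if i == n then 0 else 0) = 0) ?if_same// addr0 /frenet_rhs.
have [i_n|n_i] := ltnP i n; last first.
  have -> : i = n by lia.
  by rewrite dVn dotvZl mulNr (ltnW n2) sub0r.
have [i1|i1] := leqP i 1.
  have -> : i = 1%N by lia.
  by rewrite dV1 dotvZl subr0.
have i2n : (2 <= i <= n.-1)%N by lia.
by rewrite dVi// dotvDl !dotvZl mulNr addrC.
Qed.

Lemma frenet_curvature_smooth i : (1 <= i <= n.-1)%N -> smooth_on I (k i).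
Proof.
move=> i1n; have [sV _ onV dV] := frV.
have sVi : smooth_on I (V i) by apply: sV; lia.
have sVi1 : smooth_on I (V i.+1) by apply: sV; lia.
have := smooth_on_dotv I_open (smooth_on_derive1 sVi) sVi1.
apply: (smooth_on_congr I_open) => s Is; have [dV1 dVi _] := dV s Is.
have [i1|i1] := leqP i 1.
  have -> : i = 1%N by lia.
  by rewrite dV1 dotvZl onV ?eqxx ?mulr1//; lia.
have i2n : (2 <= i <= n.-1)%N by lia.
rewrite dVi// dotvDl !dotvZl !onV//; try lia.
have -> : (i.-1 == i.+1) = false by lia.
by rewrite eqxx mulr1 mulr0 add0r.
Qed.

Context (k_neq0 : forall i s, (1 <= i <= n.-1)%N -> I s -> k i s != 0).
Context (I_itv : is_interval I) (I_neq0 : I !=set0).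
Local Notation G := (slant_G k).

(** The smooth functions vanishing on I are the sums for A = B = I, so the
ideal argument also rules out that G_n vanishes identically. *)
Lemma V2_constant_slant_G X :
  (forall s, I s -> dotv (V 2%N s) X = 1) ->
  [/\ antiderivative_on I (k 1%N) (fun s => dotv (V 1%N s) X),
      exists C : R, forall s, I s ->
        \sum_(1 <= i < n.+1) G (fun s => dotv (V 1%N s) X) i s ^+ 2 = C &
      exists2 s, I s & G (fun s => dotv (V 1%N s) X) n s != 0].
Proof.
move=> V2X; set x := fun i s => dotv (V i s) X.
have dx : frenet_system (I:=I) n k (fun=> 0) x := frenet_frame_system X.
have GE i s : (1 <= i <= n)%N -> I s -> G (x 1%N) i s = x i s.
  move=> i1n; apply: (slant_G_unique I_open k_neq0 (ltnW n2) dx) => //.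
split.
- have := dx 1%N ltac:(lia).
  apply: antiderivative_on_congr => // s Is.
  by rewrite /frenet_rhs (ltnW n2) (ltn_eqF (ltnW n2)) subr0 addr0 /x V2X
    ?mulr1.
- have [s0 Is0] := I_neq0.
  exists (\sum_(1 <= i < n.+1) x i s0 * x i s0) => s Is.
  have -> : \sum_(1 <= i < n.+1) G (x 1%N) i s ^+ 2 =
      \sum_(1 <= i < n.+1) x i s * x i s.
    by apply: eq_big_nat => i i1n; rewrite GE// expr2.
  exact (frenet_system_pairing_cst I_open I_itv (ltnW (ltnW n2)) dx dx Is Is0).
- apply: contrapT => Gn0.
  have xn0 s : I s -> x n s = 0.
    move=> Is; have [//|xn] := eqVneq (x n s) 0.
    by exfalso; apply: Gn0; exists s => //; rewrite -/(x 1%N) GE//; lia.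
  have split0 f : (forall s, I s -> f s = 0) -> zero_split (I:=I) I I f.
    move=> f0; exists (fun=> 0), (fun=> 0).
    by split; rewrite ?addr0//; try exact: (smooth_on_cst I_open).
  have [p [q [_ _ p0 q0 xE]]] : zero_split (I:=I) I I (x 2%N).
    apply: (frenet_system_zero_split I_open k_neq0 frenet_curvature_smooth
      I_open I_open _ _ n2 dx) => //; exact: split0.
  have [s0 Is0] := I_neq0.
  have /eqP := xE s0 Is0.
  by rewrite /x V2X// p0// q0// addr0 oner_eq0.
Qed.

(** The constant sum of squares only says that the defect e of the last equation
is zero where G_n is not.  That G_n vanishes on no open subset of I comes from
writing G_2 = 1 as p + q in the ideal attached to the zero set and the nonzero
set of G_n: p is then locally constant on a dense set. *)
Lemma slant_G_system_exact G1 C : antiderivative_on I (k 1%N) G1 ->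
  (forall s, I s -> \sum_(1 <= i < n.+1) G G1 i s ^+ 2 = C) ->
  (exists2 s, I s & G G1 n s != 0) ->
  frenet_system (I:=I) n k (fun=> 0) (G G1).
Proof.
move=> dG1 GC [s0 Is0 Gn0].
have k_smooth := frenet_curvature_smooth.
have sG i i1n := slant_G_smooth I_open k_neq0 k_smooth dG1 n2 i1n (i:=i).
have dG := slant_G_system I_open k_neq0 k_smooth dG1 n2.
set e := fun s => _ in dG.
have n1n : (1 <= n <= n)%N by lia.
have se : smooth_on I e.
  have sk : smooth_on I (k n.-1) by apply: k_smooth; lia.
  have sG' : smooth_on I (G G1 n.-1) by apply: sG; lia.
  exact: (smooth_onD I_open (smooth_on_derive1 (sG n n1n))
    (smooth_onM I_open sk sG')).
have eGn s : I s -> e s * G G1 n s = 0.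
  move=> Is.
  have d2 := frenet_system_pairing (ltnW (ltnW n2)) dG dG.
  have d0 : antiderivative_on I (fun=> 0)
      (fun s => \sum_(1 <= i < n.+1) G G1 i s * G G1 i s).
    by apply: antiderivative_on_congr (antiderivative_on_cst C) => // t /GC.
  have := antiderivative_on_uniq d2 d0 Is.
  by rewrite [G G1 n s * _]mulrC -mulr2n => /eqP; rewrite mulrn_eq0 => /eqP.
pose U := nonzero_set (I:=I) (G G1 n); pose Z := zero_interior (I:=I) (G G1 n).
have UI : U `<=` I by move=> s [].
have ZI : Z `<=` I by move=> s /zero_interiorS[].
have oU : open U := nonzero_set_open I_open (dG n n1n).
have oZ : open Z by exact: zero_interior_open.
have eU s : U s -> e s = 0.
  move=> [Is Gs0]; have /eqP := eGn s Is.
  by rewrite mulf_eq0 => /orP[/eqP//|]; rewrite (negPf Gs0).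
have Je : zero_split (I:=I) Z U e.
  exists (fun=> 0), e; split=> //; first exact: (smooth_on_cst I_open).
  by move=> s _; rewrite add0r.
have JG : zero_split (I:=I) Z U (G G1 n).
  exists (G G1 n), (fun=> 0); split.
  - exact: sG.
  - exact: (smooth_on_cst I_open).
  - by move=> s /zero_interiorS[].
  - by [].
  - by move=> s _; rewrite addr0.
have [p [q [sp sq pZ qU pq]]] :=
  frenet_system_zero_split I_open k_neq0 k_smooth oZ oU ZI UI n2 dG Je JG.
have pU s : U s -> p s = 1.
  by move=> Us; have := pq s (UI s Us); rewrite /= qU// addr0.
have dp := smooth_on_antiderivative sp.
have ddp := smooth_on_antiderivative (smooth_on_derive1 sp).
have dp0 : antiderivative_on I (fun=> 0) p.
  apply: antiderivative_on_congr (dp) => // s Is.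
  apply: (zero_or_nonzero_dense I_open ddp (g:=G G1 n)) => // t.
  - exact: antiderivative_on_open_cst oU UI dp pU.
  - exact: antiderivative_on_open_cst oZ ZI dp pZ.
have Z0 s : ~ Z s.
  move=> Zs; have := antiderivative_on_eq0_cst I_itv dp0 (ZI s Zs) Is0.
  rewrite pZ// pU//; first by move/eqP; rewrite eq_sym oner_eq0.
have e0 s : I s -> e s = 0.
  move=> Is.
  apply: (zero_or_nonzero_dense I_open (smooth_on_antiderivative se)
    (g:=G G1 n)) => // t.
  by move/Z0.
move=> i i1n; apply: antiderivative_on_congr (dG i i1n) => // s Is.
by rewrite e0.
Qed.

Lemma slant_G_V2_constant G1 C : antiderivative_on I (k 1%N) G1 ->
  (forall s, I s -> \sum_(1 <= i < n.+1) G G1 i s ^+ 2 = C) ->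
  (exists2 s, I s & G G1 n s != 0) ->
  exists W, dotv W W = C /\ (forall s, I s -> dotv (V 2%N s) W = 1).
Proof.
move=> dG1 GC Gn0; have dG := slant_G_system_exact dG1 GC Gn0.
pose W s := \sum_(1 <= i < n.+1) G G1 i s *: V i s.
have [s0 Is0] := I_neq0; exists (W s0).
have [_ _ onV _] := frV.
(* each coordinate of W pairs G with the components of a basis vector *)
have Wcst s : I s -> W s = W s0.
  move=> Is; apply/rowP => c; rewrite !summxE.
  have WE t : \sum_(1 <= i < n.+1) (G G1 i t *: V i t) 0 c =
      \sum_(1 <= i < n.+1) G G1 i t * dotv (V i t) (delta_mx 0 c).
    by apply: eq_bigr => i _; rewrite mxE dotv_delta.
  rewrite !WE; exact: (frenet_system_pairing_cst I_open I_itv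
    (ltnW (ltnW n2)) dG (frenet_frame_system (delta_mx 0 c)) Is Is0).
have dotW i s : (1 <= i <= n)%N -> I s -> dotv (W s) (V i s) = G G1 i s.
  move=> i1n Is; rewrite dotv_suml (bigD1_seq i) ?iota_uniq//=; last first.
    by rewrite mem_index_iota.
  rewrite onV// eqxx mulr1 big_nat_cond big1 ?addr0// => j /andP[j1n ji].
  by rewrite onV// (negPf ji) mulr0.
split.
  rewrite -(GC s0 Is0) [LHS]dotv_suml; apply: eq_big_nat => i i1n.
  by rewrite dotvC dotW// expr2.
by move=> s Is; rewrite -(Wcst s Is) dotvC dotW//; lia.
Qed.

End Frenet.

(** * Slant helices *)

Lemma cos_eq0_pihalf (R : realType) (phi : R) :
  0 <= phi <= pi -> (cos phi == 0) = (phi == pi / 2).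
Proof.
move=> phi_itv; apply/eqP/eqP => [c0|->]; last exact: cos_pihalf.
by rewrite -(cosK (x:=phi)) ?c0 ?acos0// in_itv.
Qed.

Theorem theorem5p1 (R : realType) (n : nat) (hn : (3 <= n)%N)
    (I : set R) (I_open : open I) (I_itv : is_interval I) (I_neq0 : I !=set0)
    (alpha : R -> 'rV[R]_n) (V : nat -> R -> 'rV[R]_n) (k : nat -> R -> R)
    (alpha_smooth : smooth_on I alpha)
    (alpha_unit : unit_speed I alpha)
    (alpha_frenet : frenet_frame I alpha V k)
    (k_neq0 : forall i s, (1 <= i <= n.-1)%N -> I s -> k i s != 0) :
  V2_slant_helix I V <->
  exists G1 : R -> R,
    [/\ antiderivative_on I (k 1%N) G1,
        exists C : R, forall s, I s ->
          \sum_(1 <= i < n.+1) slant_G k G1 i s ^+ 2 = C &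
        exists2 s, I s & slant_G k G1 n s != 0].
Proof.
split=> [[X [phi [_ phi_itv phi2 V2X]]]|[G1 [dG1 [C GC] Gn0]]].
  have c0 : cos phi != 0 by rewrite cos_eq0_pihalf.
  exists (fun s => dotv (V 1%N s) ((cos phi)^-1 *: X)).
  apply: (V2_constant_slant_G I_open hn alpha_frenet) => // s Is.
  by rewrite dotvC dotvZl dotvC V2X// mulVf.
have [W [WC V2W]] :=
  slant_G_V2_constant I_open hn alpha_frenet k_neq0 I_itv I_neq0 dG1 GC Gn0.
(* the term G_2 = 1 of the sum makes 1 / sqrt C a cosine *)
have C1 : 1 <= C.
  have [s Is] := I_neq0; rewrite -(GC s Is) (bigD1_seq 2%N) ?iota_uniq//=.
    by rewrite expr1n lerDl sumr_ge0// => i _; exact: sqr_ge0.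
  by rewrite mem_index_iota; lia.
have C0 : 0 < C := lt_le_trans ltr01 C1.
have sC0 : 0 < (Num.sqrt C)^-1 by rewrite invr_gt0 sqrtr_gt0.
have sC1 : -1 <= (Num.sqrt C)^-1 <= 1.
  rewrite (le_trans _ (ltW sC0)) ?lerN10//= invf_le1 ?sqrtr_gt0//.
  by rewrite -[leLHS]sqrtr1 ler_wsqrtr.
have cosE : cos (acos (Num.sqrt C)^-1) = (Num.sqrt C)^-1.
  by rewrite acosK// in_itv.
have phi_itv : 0 <= acos (Num.sqrt C)^-1 <= pi.
  by rewrite acos_ge0// acos_lepi.
exists ((Num.sqrt C)^-1 *: W), (acos (Num.sqrt C)^-1); split=> //.
- rewrite dotvZl dotvC dotvZl WC mulrA -invfM -expr2 sqr_sqrtr ?ltW//.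
  by rewrite mulVf// gt_eqF.
- by rewrite -cos_eq0_pihalf// cosE gt_eqF.
- by move=> s Is; rewrite dotvC dotvZl dotvC V2W// mulr1 cosE.
Qed.
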